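(* Let $m$ be a positive even integer, let $n\in\mathbb{N}$, let $\boldsymbol{x}_1,\ldots,\boldsymbol{x}_n\in\Omega$ be pairwise distinct points, let $f\in\mathcal{B}^{m/(m-1)}$, and suppose $y_i=f(\boldsymbol{x}_i)$ for $i=1,\ldots,n$. Let $s_m(\boldsymbol{x})=\mathsf{B}_m(\boldsymbol{x})\boldsymbol{c}^{m-1}$ for $\boldsymbol{x}\in\Omega$, where $\boldsymbol{c}\in\mathbb{R}^n$ is the unique solution of $\mathsf{A}_m\boldsymbol{c}^{m-1}=\boldsymbol{y}$ with $\boldsymbol{y}=(y_1,\ldots,y_n)^T$. Then $$|s_m(\boldsymbol{x})-f(\boldsymbol{x})|\le 2\,\|f\|_{\mathcal{B}^{m/(m-1)}}\,P_m(\boldsymbol{x}),\qquad\text{for all }\boldsymbol{x}\in\Omega,$$ where $P_m$ is the generalized power function $$P_m(\boldsymbol{x}):=\min_{\vartheta_1,\ldots,\vartheta_n\in\mathbb{R}}\Big\|\Phi_2(\boldsymbol{x},\cdot)-\sum_{i=1}^n\vartheta_i\Phi_2(\boldsymbol{x}_i,\cdot)\Big\|_{\mathcal{B}^m}.$$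
   Context: Standing setting: $\Omega\subseteq\mathbb{R}^d$ is a compact domain and $\Phi_2:\Omega\times\Omega\to\mathbb{R}$ is a continuous symmetric positive definite kernel, meaning that $\sum_{i,j=1}^{n}\Phi_2(\boldsymbol{x}_i,\boldsymbol{x}_j)c_ic_j>0$ for all $n\in\mathbb{N}$, all pairwise distinct $\boldsymbol{x}_1,\ldots,\boldsymbol{x}_n\in\Omega$ and all $\boldsymbol{c}\in\mathbb{R}^n\setminus\{0\}$. By Mercer's theorem, $$\Phi_2(\boldsymbol{z}_1,\boldsymbol{z}_2)=\sum_{k=1}^\infty\lambda_ke_k(\boldsymbol{z}_1)e_k(\boldsymbol{z}_2),\qquad \boldsymbol{z}_1,\boldsymbol{z}_2\in\Omega,$$ converging absolutely and uniformly, where $\lambda_k>0$ and $e_k$ are the (fixed) eigenvalues and continuous eigenfunctions of $\Phi_2$ (as an integral operator on $\mathrm{L}_2(\Omega)$), the $e_k$ forming an orthonormal basis of $\mathrm{L}_2(\Omega)$. Put $\phi_k:=\lambda_k^{1/2}e_k$ and assume $\sum_{k=1}^\infty|\phi_k(\boldsymbol{x})|<\infty$ for all $\boldsymbol{x}\in\Omega$. For integers $m\ge2$ define $$\Phi_m(\boldsymbol{z}_1,\ldots,\boldsymbol{z}_m):=\sum_{k=1}^\infty\prod_{i=1}^m\phi_k(\boldsymbol{z}_i),\qquad \boldsymbol{z}_1,\ldots,\boldsymbol{z}_m\in\Omega,$$ which is well-defined (and agrees with $\Phi_2$ for $m=2$). Banach space: for $1<p<\infty$, $\mathcal{B}^p$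 is the space of functions $f=\sum_{k=1}^\infty\alpha_k\phi_k$ on $\Omega$ with real coefficient sequences $\boldsymbol{\alpha}=(\alpha_k)_{k\in\mathbb{N}}$ satisfying $\|\boldsymbol{\alpha}\|_p=(\sum_k|\alpha_k|^p)^{1/p}<\infty$, normed by $\|f\|_{\mathcal{B}^p}:=\|\boldsymbol{\alpha}\|_p$. For each $\boldsymbol{x}\in\Omega$, $\Phi_2(\boldsymbol{x},\cdot)=\sum_k\phi_k(\boldsymbol{x})\phi_k$ belongs to $\mathcal{B}^p$ for every $1<p<\infty$. Given pairwise distinct points $\boldsymbol{x}_1,\ldots,\boldsymbol{x}_n\in\Omega$ and $\boldsymbol{c}=(c_1,\ldots,c_n)^T\in\mathbb{R}^n$, put $\mathsf{A}_m:=(\Phi_m(\boldsymbol{x}_{i_1},\ldots,\boldsymbol{x}_{i_m}))_{i_1,\ldots,i_m=1}^{n,\ldots,n}$ and $\mathsf{B}_m(\boldsymbol{x}):=(\Phi_m(\boldsymbol{x},\boldsymbol{x}_{i_1},\ldots,\boldsymbol{x}_{i_{m-1}}))_{i_1,\ldots,i_{m-1}=1}^{n,\ldots,n}$ for $\boldsymbol{x}\in\Omega$, and $$\mathsf{A}_m\boldsymbol{c}^{m-1}:=\Big(\sum_{i_2,\ldots,i_m=1}^{n,\ldots,n}\Phi_m(\boldsymbol{x}_{i_1},\boldsymbol{x}_{i_2},\ldots,\boldsymbol{x}_{i_m})c_{i_2}\cdots c_{i_m}\Big)_{i_1=1}^n\in\mathbb{R}^n,$$ $$\mathsf{B}_m(\boldsymbol{x})\boldsymbol{c}^{m-1}:=\sum_{i_1,\ldots,i_{m-1}=1}^{n,\ldots,n}\Phi_m(\boldsymbol{x},\boldsymbol{x}_{i_1},\ldots,\boldsymbol{x}_{i_{m-1}})c_{i_1}\cdots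 c_{i_{m-1}}\in\mathbb{R}.$$ For even $m$ the system $\mathsf{A}_m\boldsymbol{c}^{m-1}=\boldsymbol{y}$ has a unique solution for every $\boldsymbol{y}\in\mathbb{R}^n$, so $s_m$ is well-defined. *)

(* Defs.v *)
From HB Require Import structures.
From mathcomp Require Import all_boot all_order all_algebra.
From mathcomp Require Import all_classical all_reals all_analysis.

Set Implicit Arguments.
Unset Strict Implicit.
Unset Printing Implicit Defensive.
Import Order.TTheory GRing.Theory Num.Theory.
Import numFieldNormedType.Exports.
Local Open Scope classical_set_scope.
Local Open Scope ring_scope.

Section lebesgue_rV.
Variable R : realType.

Definition borel_rV (d : nat) := g_sigma_algebraType (@open 'rV[R]_d).

Definition cons_rV (d : nat) (xv : R * 'rV[R]_d) : 'rV[R]_d.+1 :=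
  \row_i oapp (xv.2 ord0) xv.1 (unlift ord0 i).

Lemma open_rV_bigcup_rat d (U : set 'rV[R]_d) : open U ->
  U = \bigcup_(qk in [set qk : 'rV[rat]_d * nat |
         ball (map_mx ratr qk.1 : 'rV[R]_d) qk.2.+1%:R^-1 `<=` U])
      ball (map_mx ratr qk.1 : 'rV[R]_d) qk.2.+1%:R^-1.
Proof.
move=> oU; apply/seteqP; split; last by move=> v [qk qkU] /qkU.
move=> v Uv.
have /nbhs_ballP[e /= e0 veU] : nbhs v U by exact: open_nbhs_nbhs.
have [k ke] : exists k : nat, k.+1%:R^-1 < e / 2.
  exists (Num.truncn (e / 2)^-1).
  by rewrite invf_plt ?posrE ?divr_gt0// truncnS_gt.
have k0 : (0 : R) < k.+1%:R^-1 by rewrite invr_gt0.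
have Hq (i : 'I_d) : exists q : rat, `|ratr q - v ord0 i| < k.+1%:R^-1.
  have [q] := @rat_in_itvoo R (v ord0 i - k.+1%:R^-1) (v ord0 i + k.+1%:R^-1)
    ltac:(by rewrite ltrD2l gtrN).
  by rewrite in_itv/= => qi; exists q; rewrite ltr_distl.
have [q qP] := choice Hq.
have bv : ball (map_mx ratr (\row_i q i) : 'rV[R]_d) k.+1%:R^-1 v.
  by split => // i j; rewrite !ord1 !mxE /ball/=.
exists (\row_i q i, k) => //= w bw; apply: veU.
apply: (@le_ball _ _ v (k.+1%:R^-1 + k.+1%:R^-1)).
  by rewrite [leRHS]splitr lerD// ltW.
by apply: ball_triangle bw; exact: ball_sym.
Qed.

Lemma measurable_cons_rV d :
  measurable_fun [set: measurableTypeR R * borel_rV d]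
    (@cons_rV d : _ -> borel_rV d.+1).
Proof.
apply: (@measurability _ _ _ (borel_rV d.+1) _ _ (@open 'rV[R]_d.+1)) => //.
move=> _ [U oU <-]; rewrite setTI (open_rV_bigcup_rat oU) preimage_bigcup.
rewrite bigcup_mkcond.
apply: countable_bigcupT_measurable => [|[q k]]; first exact: countableP.
case: ifPn => // _ /=.
set r : R := k.+1%:R^-1.
have r0 : 0 < r by rewrite invr_gt0.
rewrite [X in measurable X](_ : _ =
    (ball (ratr (q ord0 ord0) : R) r : set (measurableTypeR R)) `*`
    (ball (\row_j ratr (q ord0 (lift ord0 j)) : 'rV[R]_d) r
      : set (borel_rV d))).
  apply: measurableX.
    apply: measurable_realfun.open_measurable; exact: ball_open.
  by apply: sub_sigma_algebra; exact: ball_open.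
apply/seteqP; split => -[x v] /=.
- move=> [_ h]; split.
    by have := h ord0 ord0; rewrite !mxE unlift_none.
  split=> // i j; have := h ord0 (lift ord0 j).
  by rewrite !ord1 !mxE liftK.
- move=> [h1 [_ h2]]; split=> // i j; rewrite !ord1 !mxE.
  case: unliftP => [j' ->|->] //=.
  by have := h2 ord0 j'; rewrite !mxE.
Qed.

(* Lebesgue measure on the Borel sets of R^d, as an iterated product; see
   [lebesgue_rV_box] for its value on boxes. *)
Fixpoint lebesgue_rV (d : nat) : {measure set (borel_rV d) -> \bar R} :=
  match d with
  | 0 => @dirac _ (borel_rV 0) (0 : 'rV[R]_0) R
  | d'.+1 => measure_function_pushforward__canonical__measure_function_Measure
      (@lebesgue_measure R \x^ lebesgue_rV d')%E (@measurable_cons_rV d')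
  end.

Definition box_rV d (a b : 'rV[R]_d) : set 'rV[R]_d :=
  [set v : 'rV[R]_d | forall i, v ord0 i \in `[a ord0 i, b ord0 i]].

Lemma lebesgue_rV_box d (a b : 'rV[R]_d) : (forall i, a ord0 i <= b ord0 i) ->
  lebesgue_rV d (box_rV a b) = (\prod_(i < d) (b ord0 i - a ord0 i))%:E.
Proof.
elim: d a b => [|d IH] a b ab.
  by rewrite big_ord0 /= diracE mem_set//= => -[].
pose a' : 'rV[R]_d := \row_j a ord0 (lift ord0 j).
pose b' : 'rV[R]_d := \row_j b ord0 (lift ord0 j).
have mbox : measurable (box_rV a' b' : set (borel_rV d)).
  rewrite -[X in measurable X]setCK; apply: measurableC.
  apply: sub_sigma_algebra; apply: closed_openC.
  rewrite [X in closed X](_ : _ = \bigcap_(i in setT)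
    (fun v : 'rV[R]_d => v ord0 i) @^-1` [set` `[a' ord0 i, b' ord0 i]]).
    apply: closed_bigI => i _; apply: preimage_closed => [v _|].
      exact: coord_continuous.
    exact: interval_closed.
  by apply/seteqP; split => v /= h; [move=> i _; exact: h|move=> i; exact: h].
rewrite [LHS]/= /pushforward.
have -> : @cons_rV d @^-1` box_rV a b =
    [set` `[a ord0 ord0, b ord0 ord0]] `*` box_rV a' b'.
  apply/seteqP; split => -[x v] /=.
  - move=> h; split; first by have := h ord0; rewrite !mxE unlift_none.
    by move=> i; have := h (lift ord0 i); rewrite !mxE liftK.
  - move=> [h1 h2] i; rewrite !mxE; case: unliftP => [j ->|->] //=.
    by have := h2 j; rewrite !mxE.
rewrite product_measure2E//= lebesgue_measure_itv/= lte_fin.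
rewrite IH; last by move=> i; rewrite !mxE.
rewrite big_ord_recl EFinM; congr (_ * _)%E; last first.
  by congr EFin; apply: eq_bigr => i _; rewrite !mxE.
case: ltgtP (ab ord0) => // -> _; by rewrite subrr.
Qed.

End lebesgue_rV.

Section mercer.
Variables (R : realType) (d : nat).
Implicit Types (Omega : set 'rV[R]_d) (g h : 'rV[R]_d -> R).

Definition in_L2 Omega g :=
  measurable_fun (Omega : set (borel_rV R d)) (g : borel_rV R d -> R) /\
  (lebesgue_rV R d).-integrable Omega (fun z => (g z ^+ 2)%:E).

Definition L2_inner Omega g h : R :=
  \int[lebesgue_rV R d]_(z in Omega) (g z * h z).

Definition L2_orthonormal_basis Omega (e : nat -> 'rV[R]_d -> R) :=
  [/\ forall k, in_L2 Omega (e k),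
      forall j k, L2_inner Omega (e j) (e k) = (j == k)%:R &
      forall g, in_L2 Omega g ->
        let rest N z := g z - \sum_(k < N) L2_inner Omega g (e k) * e k z in
        (fun N => L2_inner Omega (rest N) (rest N)) @ \oo --> (0 : R)].

Definition positive_definite_kernel Omega (Phi2 : 'rV[R]_d -> 'rV[R]_d -> R) :=
  forall (n : nat) (x : 'I_n -> 'rV[R]_d) (c : 'cV[R]_n),
    injective x -> (forall i, Omega (x i)) -> c != 0 ->
    0 < \sum_i \sum_j Phi2 (x i) (x j) * c i ord0 * c j ord0.

Definition feature (lam : nat -> R) (e : nat -> 'rV[R]_d -> R) (k : nat)
  (z : 'rV[R]_d) : R := Num.sqrt (lam k) * e k z.

Record mercer_setting Omega (Phi2 : 'rV[R]_d -> 'rV[R]_d -> R)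
    (lam : nat -> R) (e : nat -> 'rV[R]_d -> R) : Prop := MercerSetting {
  mercer_compact : compact Omega ;
  mercer_continuous :
    {within Omega `*` Omega, continuous (fun w => Phi2 w.1 w.2)} ;
  mercer_symmetric : forall z1 z2, Omega z1 -> Omega z2 ->
    Phi2 z1 z2 = Phi2 z2 z1 ;
  mercer_posdef : positive_definite_kernel Omega Phi2 ;
  mercer_eigenvalue_gt0 : forall k, 0 < lam k ;
  mercer_eigenfun_continuous : forall k, {within Omega, continuous (e k)} ;
  mercer_eigen : forall k z, Omega z ->
    L2_inner Omega (Phi2 z) (e k) = lam k * e k z ;
  mercer_basis : L2_orthonormal_basis Omega e ;
  mercer_expansion_abs : forall z1 z2, Omega z1 -> Omega z2 ->
    cvgn [normed series (fun k => lam k * e k z1 * e k z2)] ;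
  mercer_expansion_unif :
    {uniform Omega `*` Omega,
      (fun N w => \sum_(k < N) lam k * e k w.1 * e k w.2) @ \oo -->
      (fun w => Phi2 w.1 w.2)} ;
  mercer_summable : forall z, Omega z ->
    cvgn [normed series (fun k => feature lam e k z)]
}.

End mercer.

Section interpolation.
Variables (R : realType) (d : nat).
Variables (Omega : set 'rV[R]_d) (phi : nat -> 'rV[R]_d -> R).

Definition Phi (m : nat) (z : m.-tuple 'rV[R]_d) : R :=
  limn (series (fun k => \prod_(i < m) phi k (tnth z i))).

Definition is_coef (p : R) (g : 'rV[R]_d -> R) (alpha : nat -> R) :=
  ('N[@counting nat R]_(p%:E)[EFin \o alpha] < +oo)%E /\
  forall z, Omega z -> series (fun k => alpha k * phi k z) @ \oo --> g z.

Definition in_B (p : R) (g : 'rV[R]_d -> R) := exists alpha, is_coef p g alpha.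

(* Under [mercer_setting], a function has at most one coefficient sequence, so
   [xget] returns it. The value outside B^p is a default. *)
Definition B_coef (p : R) (g : 'rV[R]_d -> R) : nat -> R :=
  xget (fun=> 0) [set alpha | is_coef p g alpha].

Definition B_norm (p : R) (g : 'rV[R]_d -> R) : R :=
  fine ('N[@counting nat R]_(p%:E)[EFin \o B_coef p g])%E.

Section points.
Variables (n : nat) (x : 'I_n -> 'rV[R]_d).

Definition tensor_A (m : nat) (i : m.-tuple 'I_n) : R := Phi [tuple of map x i].

Definition tensor_B (m : nat) (z : 'rV[R]_d) (i : (m.-1).-tuple 'I_n) : R :=
  Phi [tuple of z :: map x i].

Definition tensor_A_apply (m : nat) (c : 'cV[R]_n) : 'cV[R]_n :=
  \col_(i1 < n) \sum_(i : (m.-1).-tuple 'I_n)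
    tensor_A [tuple of i1 :: i] * \prod_(j < m.-1) c (tnth i j) ord0.

Definition tensor_B_apply (m : nat) (z : 'rV[R]_d) (c : 'cV[R]_n) : R :=
  \sum_(i : (m.-1).-tuple 'I_n)
    tensor_B z i * \prod_(j < m.-1) c (tnth i j) ord0.

Definition power_residual (Phi2 : 'rV[R]_d -> 'rV[R]_d -> R) (z : 'rV[R]_d)
  (theta : 'cV[R]_n) : 'rV[R]_d -> R :=
  fun w => Phi2 z w - \sum_(i < n) theta i ord0 * Phi2 (x i) w.

Definition power_norms (m : nat) (Phi2 : 'rV[R]_d -> 'rV[R]_d -> R)
    (z : 'rV[R]_d) : set R :=
  [set B_norm m%:R (power_residual Phi2 z theta) | theta in [set: 'cV[R]_n]].

Definition power_function (m : nat) (Phi2 : 'rV[R]_d -> 'rV[R]_d -> R)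
    (z : 'rV[R]_d) : R := inf (power_norms m Phi2 z).

End points.
End interpolation.

(* Main.v *)
(* Let [u_k = \sum_j c_j phi_k(x_j)]. The coefficients of [s] are
   [b_k = u_k ^ (m - 1)], with [m/(m-1)]-norm [|u|_m ^ (m - 1)]. Since [m] is
   even, interpolation gives
   [|u|_m ^ m = \sum_i c_i s(x_i) = \sum_i c_i f(x_i) = \sum_k a_k u_k]
   for the coefficients [a] of [f]. Hoelder's inequality gives [|b| <= |a|]. As
   [s - f] vanishes at the points [x_i], [s(z) - f(z)] is the pairing of
   [b - a] with the coefficients of any residual
   [Phi2(z, .) - \sum_i theta_i Phi2(x_i, .)], and Hoelder's inequality applies
   again.

   The norm of [B^p] is well defined because bounded coefficients of the zero
   function vanish: [\sum_k lam_k] converges, and Fatou's lemma bounds the L2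
   norm of a partial sum by that of the tail. The minimum defining the power
   function exists because positive definiteness makes the sequences
   [phi_k(x_i)] linearly independent, so that the distance is coercive in
   [theta]. *)

Require Import Defs.
From mathcomp Require Import all_boot all_order all_algebra.
From mathcomp Require Import all_classical all_reals all_analysis.
From mathcomp Require Import measurable_realfun ring lra.

Import Order.TTheory GRing.Theory Num.Theory.
Import numFieldNormedType.Exports.
Local Open Scope classical_set_scope.
Local Open Scope ring_scope.

(** * Convergent series, and sums over tuples *)

Section series_facts.
Context {R : realType}.
Implicit Types a b : nat -> R.

Lemma cvg_series_lin {I : finType} {t : I -> R} {F : I -> nat -> R}
    {l : I -> R} :
  (forall i, series (F i) @ \oo --> l i) ->
  series (fun k => \sum_i t i * F i k) @ \oo --> \sum_i t i * l i.
Proof.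
move=> Fl; rewrite (_ : series _ = fun n => \sum_i t i * series (F i) n).
  apply: cvg_big => [|i _]; first exact: add_continuous.
  by apply: cvgM; [exact: cvg_cst|exact: Fl].
apply/funext => n; rewrite /series/= exchange_big/=; apply: eq_bigr => i _.
by rewrite mulr_sumr.
Qed.

Lemma cvg_seriesB {a b} {la lb : R} :
  series a @ \oo --> la -> series b @ \oo --> lb ->
  series (fun k => a k - b k) @ \oo --> la - lb.
Proof.
move=> al bl; rewrite [X in X @ _](_ : _ = series a - series b).
  exact: cvgB.
by apply/funext => n; rewrite fctE /series/= -sumrB.
Qed.

Lemma normed_series_bounded {a} : cvgn [normed series a] ->
  exists2 C : R, 0 <= C & forall k, `|a k| <= C.
Proof.
(* Every constant above [M] is a bound; [|M| + 1] is one that is also nonnegative. *)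
move=> ca; have [M [_ /(_ (`|M| + 1))]] := cvg_series_bounded ca.
rewrite (le_lt_trans (ler_norm _))// ?ltrDl// => /(_ isT) h.
exists (`|M| + 1) => [|k]; first by rewrite addr_ge0.
by have := h k I; rewrite /= normr_id.
Qed.

Lemma normed_series_mul_bounded {a b C} : cvgn [normed series a] ->
  (forall k, `|b k| <= C) -> cvgn [normed series (fun k => a k * b k)].
Proof.
move=> ca bC; apply: (@series_le_cvg _ _ (fun k => C * `|a k|)).
- by move=> k; exact: normr_ge0.
- by move=> k; rewrite mulr_ge0// (le_trans _ (bC k)).
- by move=> k; rewrite /= normrM mulrC ler_wpM2r.
- exact: (@is_cvg_seriesZ _ (fun k => `|a k|) C).
Qed.

(** Distributivity, with tuples reindexed as finite functions. It collapses the contraction of a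
    tensor with [c] into a power of one linear form. *)
Lemma sum_tuple_prod m n (F : 'I_n -> R) :
  \sum_(t : m.-tuple 'I_n) \prod_(j < m) F (tnth t j) = (\sum_i F i) ^+ m.
Proof.
rewrite -[X in _ ^+ X]card_ord -prodr_const bigA_distr_bigA/=.
rewrite (reindex (fun t : m.-tuple 'I_n => [ffun j => tnth t j]))/=.
  by apply: eq_bigr => t _; apply: eq_bigr => j _; rewrite ffunE.
exists (fun f : {ffun 'I_m -> 'I_n} => [tuple f j | j < m]) => [t _|f _].
  by apply: eq_from_tnth => j; rewrite tnth_mktuple ffunE.
by apply/ffunP => j; rewrite ffunE tnth_mktuple.
Qed.

End series_facts.


(** * The spaces l^p, with Minkowski's and Hoelder's inequalities *)

Section sequence_spaces.
Context {R : realType}.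
Implicit Types (p q : R) (a b : nat -> R).

Definition in_lp p a := ('N[@counting nat R]_(p%:E)[EFin \o a] < +oo)%E.

(** [fine] sends an infinite norm to 0, so the value is meaningful only under [in_lp]. *)
Definition lp_norm p a : R := fine ('N[@counting nat R]_(p%:E)[EFin \o a])%E.

Lemma lim_series_EFin {a} : cvgn (series a) ->
  (\sum_(k <oo) (a k)%:E)%E = (limn (series a))%:E.
Proof.
move=> ca; apply: cvg_lim => //.
have -> : (fun n => \sum_(0 <= k < n) (a k)%:E)%E = EFin \o series a.
  by apply/funext => n /=; rewrite sumEFin.
by apply: cvg_EFin; [exact: nearW|exact: ca].
Qed.

Lemma LnormE {p a} : 0 < p ->
  ('N[@counting nat R]_(p%:E)[EFin \o a] =
   (\sum_(k <oo) (`|a k| `^ p)%:E) `^ p^-1)%E.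
Proof. by move=> p0; rewrite Lnorm_counting. Qed.

Lemma in_lpP {p a} : 0 < p ->
  in_lp p a <-> cvgn (series (fun k => `|a k| `^ p)).
Proof.
move=> p0; rewrite /in_lp LnormE//; split.
  move/lty_poweRy => h; apply: nnseries_is_cvg => [k|].
    exact: powR_ge0.
  by apply: h; rewrite gt_eqF// invr_gt0.
by move=> ca; rewrite lim_series_EFin// poweR_EFin ltry.
Qed.

Lemma lp_norm_ge0 {p a} : 0 <= lp_norm p a.
Proof. by rewrite fine_ge0// Lnorm_ge0. Qed.

Lemma EFin_lp_norm {p a} : in_lp p a ->
  (lp_norm p a)%:E = ('N[@counting nat R]_(p%:E)[EFin \o a])%E.
Proof. by move=> fa; rewrite fineK// ge0_fin_numE// Lnorm_ge0. Qed.

Lemma lp_norm_powR {p a} : 0 < p -> in_lp p a ->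
  lp_norm p a `^ p = limn (series (fun k => `|a k| `^ p)).
Proof.
move=> p0 fa; have ca := (in_lpP p0).1 fa.
apply: EFin_inj; rewrite -poweR_EFin EFin_lp_norm// LnormE//.
rewrite -poweRrM mulVf ?gt_eqF//.
rewrite poweRe1 ?lim_series_EFin// lee_fin; apply: (limr_ge ca); near=> n.
by rewrite sumr_ge0// => k _; exact: powR_ge0.
Unshelve. all: by end_near. Qed.

Lemma Lfun_lp {p a} : in_lp p a -> a \in Lfun (@counting nat R) p%:E.
Proof. by move=> fa; rewrite inE/=; apply/andP; split; rewrite inE. Qed.

Lemma in_lpZD {p a b} t : 1 <= p -> in_lp p a -> in_lp p b ->
  in_lp p (fun k => t * a k + b k).
Proof.
move=> p1 /Lfun_lp fa /Lfun_lp fb.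
have p1' : (1 <= p%:E)%E by rewrite lee_fin.
have := Lfun_submod_closed (@counting nat R) p1'.
by move=> [_ /(_ t _ _ fa fb)]; rewrite inE => /andP[_]; rewrite inE.
Qed.

Lemma in_lp0 {p} : 0 < p -> in_lp p (fun=> 0).
Proof.
move=> p0; rewrite /in_lp (_ : EFin \o _ = cst 0%E)// Lnorm0 ?ltry//.
by rewrite eqe gt_eqF.
Qed.

Lemma in_lp_lin {p n} (t : 'I_n -> R) (b : 'I_n -> nat -> R) : 1 <= p ->
  (forall i, in_lp p (b i)) -> in_lp p (fun k => \sum_i t i * b i k).
Proof.
move=> p1; elim: n t b => [|n IH] t b fb.
  rewrite (_ : (fun _ => _) = (fun=> 0)).
    by apply/in_lp0/(lt_le_trans _ p1).
  by apply/funext => k; rewrite big_ord0.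
rewrite (_ : (fun _ => _) = (fun k => t ord0 * b ord0 k +
  \sum_i t (lift ord0 i) * b (lift ord0 i) k)).
  by apply: in_lpZD => //; exact: IH.
by apply/funext => k; rewrite big_ord_recl.
Qed.

Lemma lp_normD {p a b} : 1 <= p -> in_lp p a -> in_lp p b ->
  lp_norm p (fun k => a k + b k) <= lp_norm p a + lp_norm p b.
Proof.
move=> p1 fa fb; rewrite -lee_fin EFinD !EFin_lp_norm//.
  exact: minkowski_EFin.
rewrite (_ : (fun _ => _) = (fun k => 1 * a k + b k)); first exact: in_lpZD.
by apply/funext => k; rewrite mul1r.
Qed.

Lemma lp_normZ {p a} t : 1 <= p -> in_lp p a ->
  lp_norm p (fun k => t * a k) = `|t| * lp_norm p a.
Proof.
move=> p1 fa; have p1' : (1 <= p%:E)%E by rewrite lee_fin.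
have := LnormZ (Lfun_Sub p1' (Lfun_lp fa)) t.
rewrite Lfun_valP => h; rewrite /lp_norm; rewrite [X in fine X]h.
by rewrite fineM// ge0_fin_numE// Lnorm_ge0.
Qed.

Lemma lp_normN {p a} : lp_norm p (fun k => - a k) = lp_norm p a.
Proof.
by rewrite /lp_norm -(oppe_Lnorm _ (EFin \o a)).
Qed.

Lemma in_lpB {p a b} : 1 <= p -> in_lp p a -> in_lp p b ->
  in_lp p (fun k => a k - b k).
Proof.
move=> p1 fa fb; have := in_lpZD (-1) p1 fb fa.
by under eq_fun do rewrite mulN1r addrC.
Qed.

Lemma lp_normB {p a b} : 1 <= p -> in_lp p a -> in_lp p b ->
  lp_norm p (fun k => a k - b k) <= lp_norm p a + lp_norm p b.
Proof.
move=> p1 fa fb; rewrite -[lp_norm p b]lp_normN; apply: lp_normD => //.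
have := in_lpB p1 (in_lp0 (lt_le_trans ltr01 p1)) fb.
by under eq_fun do rewrite sub0r.
Qed.

(** One term of the series of [p]-th powers is at most its sum. This yields both the boundedness of
    l^p sequences and the definiteness of the norm. *)
Lemma lp_norm_coef {p a} k : 0 < p -> in_lp p a -> `|a k| <= lp_norm p a.
Proof.
move=> p0 fa; rewrite leNgt; apply/negP => /(gt0_ltr_powR p0).
rewrite !nnegrE lp_norm_ge0 normr_ge0 => /(_ isT isT).
apply/negP; rewrite -leNgt.
rewrite lp_norm_powR//; have ca := (in_lpP p0).1 fa.
apply: (limr_ge ca); near=> n.
rewrite /series/= big_mkord.
have kn : (k < n)%N by near: n; exact: nbhs_infty_gt.
rewrite (bigD1 (Ordinal kn))//= lerDl sumr_ge0// => i _; exact: powR_ge0.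
Unshelve. all: by end_near. Qed.

(** With [C] a bound of the sequence, [|a_k| ^ m <= C ^ (m - 1) |a_k|]. *)
Lemma l1_in_lp {a} m : (0 < m)%N -> cvgn [normed series a] -> in_lp m%:R a.
Proof.
case: m => // m _ ca; apply/in_lpP => //.
have [C C0 aC] := normed_series_bounded ca.
apply: (@series_le_cvg _ _ (fun k => C ^+ m * `|a k|)).
- by move=> k; exact: powR_ge0.
- by move=> k; rewrite mulr_ge0// exprn_ge0.
- move=> k; rewrite powR_mulrn// exprSr ler_wpM2r//.
  by rewrite lerXn2r ?nnegrE.
- exact: (@is_cvg_seriesZ _ (fun k => `|a k|) (C ^+ m)).
Qed.

(** Hoelder's inequality for the counting measure bounds the 1-norm of the product; absolute
    convergence and the bound on the sum both follow. *)
Lemma lp_hoelder {p q a b} : 0 < p -> 0 < q -> p^-1 + q^-1 = 1 ->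
  in_lp p a -> in_lp q b ->
  cvgn (series (fun k => a k * b k)) /\
  `|limn (series (fun k => a k * b k))| <= lp_norm p a * lp_norm q b.
Proof.
move=> p0 q0 pq fa fb.
have : ('N[@counting nat R]_1[EFin \o (a \* b)%R] <=
    (lp_norm p a * lp_norm q b)%:E)%E.
  by rewrite EFinM !EFin_lp_norm//; exact: hoelder.
rewrite Lnorm1 ge0_integral_count// => H.
have c : cvgn [normed series (fun k => a k * b k)].
  apply: (@nnseries_is_cvg _ (fun k => `|a k * b k|)) => //.
  exact: le_lt_trans H (ltry (_ * _)).
split; first exact: normed_cvg.
apply: (le_trans (lim_series_norm c)); rewrite -lee_fin.
by apply: le_trans H; rewrite -(lim_series_EFin c).
Qed.

(** For [q = m / (m - 1)] one has [(m - 1) q = m], so the [q]-th powers of the new terms are the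
    [m]-th powers of the old ones, and the two sides have the same [q]-th power. *)
Lemma lp_norm_exprn_conj {m a} : (1 < m)%N -> in_lp m%:R a ->
  in_lp (m%:R / (m%:R - 1)) (fun k => a k ^+ m.-1) /\
  lp_norm (m%:R / (m%:R - 1)) (fun k => a k ^+ m.-1) = lp_norm m%:R a ^+ m.-1.
Proof.
case: m => [|[|m]]// _ fa; set q := _ / _.
have m1 : (m.+2%:R : R) - 1 = m.+1%:R by rewrite -(natr1 m.+1) addrK.
have q0 : 0 < q by rewrite /q m1 divr_gt0.
have powq (x : R) : 0 <= x -> (x ^+ m.+1) `^ q = x `^ m.+2%:R.
  move=> x0; rewrite -powR_mulrn// -powRrM /q m1 mulrCA divff ?pnatr_eq0//.
  by rewrite mulr1.
have E : (fun k => `|a k ^+ m.+1| `^ q) = (fun k => `|a k| `^ m.+2%:R).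
  by apply/funext => k; rewrite normrX powq.
have fq : in_lp q (fun k => a k ^+ m.+1).
  by apply/in_lpP => //; rewrite E; apply/in_lpP.
split=> //; apply: (powR_injective q0).
1,2: by rewrite ?nnegrE ?exprn_ge0 ?lp_norm_ge0.
by rewrite lp_norm_powR//= E powq ?lp_norm_ge0// lp_norm_powR.
Qed.

End sequence_spaces.

(** * Pointwise vanishing series in an orthonormal system *)

Section orthonormal_series.
Context {d : measure_display} {T : measurableType d} {R : realType}.
Variables (mu : {measure set T -> \bar R}) (D : set T) (mD : measurable D).
Variable e : nat -> T -> R.
Hypothesis me : forall k, measurable_fun D (e k).
Hypothesis ie : forall k, mu.-integrable D (fun x => (e k x ^+ 2)%:E).
Hypothesis oe : forall j k, \int[mu]_(x in D) (e j x * e k x) = (j == k)%:R.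

(** The product is dominated by the sum of the two squares. *)
Lemma integrable_mul j k : mu.-integrable D (fun x => (e j x * e k x)%:E).
Proof.
apply: (@le_integrable _ _ _ _ _ mD _
  (fun x => (e j x ^+ 2)%:E + (e k x ^+ 2)%:E)%E).
- by apply/measurable_EFinP; exact: measurable_funM.
- move=> x Dx; rewrite -EFinD /= lee_fin [leRHS]ger0_norm ?addr_ge0 ?sqr_ge0//.
  have := sqr_ge0 (e j x + e k x); have := sqr_ge0 (e j x - e k x).
  have := sqr_ge0 (e j x); have := sqr_ge0 (e k x).
  by rewrite ler_norml; nra.
- by apply: integrableD => //; exact: ie.
Qed.

(** Pythagoras: in the double sum for the square, orthonormality kills the off-diagonal
    integrals. *)
Lemma integral_sum_sqr (w : nat -> R) m n :
  (\int[mu]_(x in D) ((\sum_(m <= k < n) w k * e k x) ^+ 2)%:E =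
   (\sum_(m <= k < n) w k ^+ 2)%:E)%E.
Proof.
have iZ j k : mu.-integrable D (fun x => (w j * w k)%:E * (e j x * e k x)%:E)%E.
  by apply: integrableZl => //; exact: integrable_mul.
transitivity (\int[mu]_(x in D) \sum_(m <= j < n) \sum_(m <= k < n)
    ((w j * w k)%:E * (e j x * e k x)%:E))%E.
  apply: eq_integral => x _; rewrite expr2 mulr_suml -sumEFin.
  apply: eq_bigr => j _; rewrite mulr_sumr -sumEFin; apply: eq_bigr => k _.
  by rewrite -EFinM; congr EFin; ring.
rewrite integral_sum//; last by move=> j; exact: integrable_sum.
rewrite -sumEFin big_nat [RHS]big_nat; apply: eq_bigr => j jmn.
rewrite integral_sum//.
under eq_bigr.
  move=> k _; rewrite integralZl//; last exact: integrable_mul.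
  rewrite -[X in (_ * X)%E]fineK; last first.
    exact: integrable_fin_num (integrable_mul _ _).
  rewrite -/(Rintegral mu D (fun x => e j x * e k x)) oe -EFinM.
  over.
rewrite sumEFin (bigD1_seq j) ?mem_index_iota ?iota_uniq//= eqxx mulr1.
rewrite big1 ?addr0//.
by move=> k kj; rewrite eq_sym (negbTE kj) mulr0.
Qed.

(* Fatou: the partial sum [S_M] is the pointwise limit of [S_M - S_N], so its
   square norm is at most the tail [\sum_(k >= M) w_k ^+ 2]. *)
Lemma orthonormal_series_eq0 (w : nat -> R) :
  cvgn (series (fun k => w k ^+ 2)) ->
  (forall x, D x -> series (fun k => w k * e k x) @ \oo --> (0 : R)) ->
  forall k, w k = 0.
Proof.
move=> cw w0; set A := series (fun k => w k ^+ 2) in cw *.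
pose S M x := \sum_(0 <= k < M) w k * e k x.
have mS M N : measurable_fun D (fun x => ((S N x - S M x) ^+ 2)%:E).
  apply/measurable_EFinP/measurable_funX/measurable_funB;
    by apply: measurable_sum => k; exact: measurable_funM.
have half M : A M <= limn A - A M.
  have f0 : forall N x, D x -> (0 <= ((S N x - S M x) ^+ 2)%:E)%E.
    by move=> N x _; rewrite lee_fin sqr_ge0.
  have := fatou mu mD (mS M) f0.
  have -> : (\int[mu]_(x in D) limn_einf (fun N => ((S N x - S M x) ^+ 2)%:E) =
             (A M)%:E)%E.
    rewrite -[RHS]integral_sum_sqr; apply: eq_integral => x /[!inE] Dx.
    refine (cvg_limn_einf_sup _).1; apply: cvg_EFin; first exact: nearW.
    have h : S N x - S M x @[N --> \oo] --> 0 - S M x.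
      by apply: cvgB; [exact: w0|exact: cvg_cst].
    by have := cvgM h h; rewrite sub0r mulrNN; exact.
  suff -> : limn_einf (fun N => \int[mu]_(x in D) ((S N x - S M x) ^+ 2)%:E)%E =
            (limn A - A M)%:E by [].
  refine (cvg_limn_einf_sup _).1.
  apply: (@cvg_trans _ ((A N - A M)%:E @[N --> \oo])).
    apply: near_eq_cvg; near=> N.
    have MN : (M <= N)%N by near: N; exact: nbhs_infty_ge.
    rewrite /A sub_series_geq// -integral_sum_sqr.
    by apply: eq_integral => x _; rewrite -sub_series_geq.
  apply: cvg_EFin; first exact: nearW.
  by apply: cvgB; [exact: cw|exact: cvg_cst].
(* By [half], every partial sum is at most half of the limit. *)
have L0 : limn A <= 0.
  have : limn A <= limn A / 2.
    by apply: (limr_le cw); apply: nearW => M; have := half M; lra.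
  by lra.
move=> k; apply/eqP; rewrite -sqrf_eq0 eq_le sqr_ge0 andbT.
apply: le_trans L0; apply: (limr_ge cw); near=> n.
have kn : (k < n)%N by near: n; exact: nbhs_infty_gt.
rewrite /A /series/= big_mkord (bigD1 (Ordinal kn))//= lerDl.
by rewrite sumr_ge0// => i _; exact: sqr_ge0.
Unshelve. all: by end_near. Qed.

End orthonormal_series.

Lemma ler_rV_norm (R : realDomainType) n (v : 'rV[R]_n) i :
  `|v ord0 i| <= mx_norm v.
Proof. by rewrite mx_normrE; apply/bigmax_geP; right; exists (ord0, i). Qed.

(** * Consequences of the Mercer expansion, and uniqueness of coefficients *)

Section mercer_theory.
Context {R : realType} {d : nat}.

Lemma compact_measurable_rV {A : set 'rV[R]_d} : compact A ->
  measurable (A : set (borel_rV R d)).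
Proof.
move=> cA; rewrite -[X in measurable X]setCK; apply: measurableC.
apply: sub_sigma_algebra; apply: closed_openC.
by apply: compact_closed => //; exact: norm_hausdorff.
Qed.

(** A compact set lies in a cube, whose measure is given by [lebesgue_rV_box]. *)
Lemma compact_lebesgue_rV_lty {A : set 'rV[R]_d} : compact A ->
  (lebesgue_rV R d A < +oo)%E.
Proof.
move=> cA; have [M [_ /(_ (`|M| + 1))]] := compact_bounded cA.
rewrite (le_lt_trans (ler_norm _))// ?ltrDl// => /(_ isT) AM.
pose b : 'rV[R]_d := const_mx (`|M| + 1).
have cB : compact (box_rV (- b) b).
  have := @rV_compact R d (fun i => [set` `[(- b) ord0 i, b ord0 i]]).
  by apply => i; exact: segment_compact.
apply: (@le_lt_trans _ _ (lebesgue_rV R d (box_rV (- b) b))).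
  apply: le_measure; rewrite ?inE.
  - exact: compact_measurable_rV.
  - exact: compact_measurable_rV.
  - move=> v /AM vM i; rewrite !mxE in_itv/= -ler_norml.
    exact: le_trans (ler_rV_norm _ _ _ _) vM.
rewrite lebesgue_rV_box ?ltry// => i; rewrite !mxE ge0_cp// addr_ge0//.
Qed.

Variables (Omega : set 'rV[R]_d) (Phi2 : 'rV[R]_d -> 'rV[R]_d -> R).
Variables (lam : nat -> R) (e : nat -> 'rV[R]_d -> R).
Hypothesis HOmega : mercer_setting Omega Phi2 lam e.
Local Notation phi := (feature lam e).
Local Notation mu := (lebesgue_rV R d).

Let mOmega : measurable (Omega : set (borel_rV R d)) :=
  compact_measurable_rV (mercer_compact HOmega).
Let lam0 : forall k, 0 < lam k := mercer_eigenvalue_gt0 HOmega.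

Lemma feature_mul k z w : phi k z * phi k w = lam k * e k z * e k w.
Proof. by rewrite /feature mulrACA -expr2 sqr_sqrtr ?mulrA// ltW. Qed.

(** Unpacks the uniform topology into a threshold on [N] that serves all points of [Omega] at
    once. *)
Lemma mercer_unif_near (eps : R) : 0 < eps -> \forall N \near \oo,
  forall z w, Omega z -> Omega w ->
    `|Phi2 z w - series (fun k => phi k z * phi k w) N| < eps.
Proof.
move=> eps0; have := mercer_expansion_unif HOmega.
pose V := [set h : 'rV[R]_d * 'rV[R]_d -> R |
  forall y, (Omega `*` Omega) y -> ball (Phi2 y.1 y.2) eps (h y)].
move=> /(_ V).
have h : nbhs ((fun w => Phi2 w.1 w.2) : {uniform` Omega `*` Omega -> R}) V.
  apply/uniform_nbhs; exists [set xy | ball xy.1 eps xy.2]; split.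
    exact: (entourage_ball R (PosNum eps0)).
  by move=> g /= hg y Oy; exact: hg.
move=> /(_ h)[N0 _ hN0]; exists N0 => // N /hN0 /= hN z w Oz Ow.
have := hN (z, w) (conj Oz Ow); rewrite /ball/= /series/= big_mkord.
by under eq_bigr do rewrite -feature_mul.
Qed.

Lemma mercer_series z w : Omega z -> Omega w ->
  series (fun k => phi k z * phi k w) @ \oo --> Phi2 z w.
Proof.
move=> Oz Ow; apply/cvgrPdist_lt => eps eps0.
by apply: filterS (mercer_unif_near _ eps0) => N; exact.
Qed.

Let ie k : mu.-integrable Omega (fun z => (e k z ^+ 2)%:E).
Proof. by have [+ _ _] := mercer_basis HOmega => /(_ k)[]. Qed.

Let me k : measurable_fun (Omega : set (borel_rV R d)) (e k).
Proof. by have [+ _ _] := mercer_basis HOmega => /(_ k)[]. Qed.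

Let oe j k : \int[mu]_(z in Omega) (e j z * e k z) = (j == k)%:R.
Proof. by have [_ + _] := mercer_basis HOmega; exact. Qed.

(* The diagonal of the kernel is integrable and the integral of its [k]-th term
   is [lam k]; by uniform convergence it suffices to bound the tails. *)
Lemma mercer_lam_summable : cvgn (series lam).
Proof.
have [N _ HN] := mercer_unif_near 1 ltr01.
rewrite -(is_cvg_series_restrict N) /=.
have muO : mu Omega \is a fin_num.
  rewrite ge0_fin_numE//.
  exact: compact_lebesgue_rV_lty (mercer_compact HOmega).
apply: nondecreasing_is_cvgn.
  apply/nondecreasing_seqP => n.
  have [Nn|nN] := leqP N n; first by rewrite big_nat_recr//= lerDl ltW.
  by rewrite !big_geq// ltnW.
(* On the diagonal, the partial sums from [N] on are within 1 of the kernel, so two of them differ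
   by at most 2 pointwise. *)
exists (2 * fine (mu Omega)) => _ [n _ <-].
have [Nn|nN] := leqP N n; last first.
  by rewrite big_geq ?(ltnW nN)// mulr_ge0// fine_ge0.
have ile k : mu.-integrable Omega (fun z => (lam k * e k z ^+ 2)%:E).
  by under eq_fun do rewrite EFinM; exact: integrableZl.
have intle k : (\int[mu]_(z in Omega) (lam k * e k z ^+ 2)%:E = (lam k)%:E)%E.
  under eq_integral do rewrite EFinM.
  rewrite integralZl// -[X in (_ * X)%E]fineK; last exact: integrable_fin_num.
  by rewrite -/(Rintegral mu Omega (fun x => e k x * e k x)) oe eqxx mule1.
rewrite -lee_fin -sumEFin; under eq_bigr do rewrite -intle.
rewrite -integral_sum//; under eq_integral do rewrite sumEFin.
rewrite EFinM fineK// -integral_cst//; apply: ge0_le_integral => //.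
- move=> z _; rewrite lee_fin sumr_ge0// => k _.
  by rewrite mulr_ge0 ?sqr_ge0// ltW.
- apply/measurable_EFinP; apply: measurable_sum => k.
  by apply: measurable_funM => //; exact: measurable_funX.
move=> z Oz; rewrite lee_fin.
have := HN n Nn z z Oz Oz; have := HN N (leqnn N) z z Oz Oz.
rewrite !ltr_norml => /andP[? ?] /andP[? ?].
have := @sub_series_geq _ (fun k => phi k z * phi k z) _ _ Nn.
under [X in _ = X -> _]eq_bigr do rewrite feature_mul -mulrA -expr2.
by lra.
Qed.

(** The series is one in the [e_k] with coefficients [a_k sqrt(lam_k)]. These are square summable,
    as [a] is bounded and [lam] summable, hence zero; the factor [sqrt(lam_k)] is positive. *)
Lemma coef_eq0 p (a : nat -> R) : 1 <= p -> in_lp p a ->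
  (forall z, Omega z -> series (fun k => a k * phi k z) @ \oo --> (0 : R)) ->
  forall k, a k = 0.
Proof.
move=> p1 fa a0 k; have p0 : 0 < p by exact: lt_le_trans p1.
have := orthonormal_series_eq0 mu Omega mOmega e me ie oe
  (fun k => a k * Num.sqrt (lam k)) _ _ k.
have cw : cvgn (series (fun k => (a k * Num.sqrt (lam k)) ^+ 2)).
  apply: (@series_le_cvg _ _ (fun k => lp_norm p a ^+ 2 * lam k)).
  - by move=> j; exact: sqr_ge0.
  - by move=> j; rewrite mulr_ge0 ?sqr_ge0 ?ltW.
  - move=> j; rewrite exprMn (sqr_sqrtr (ltW (lam0 j))) ler_pM2r//.
    rewrite -real_normK ?num_real// lerXn2r ?nnegrE ?lp_norm_ge0//.
    exact: lp_norm_coef.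
  - exact: (@is_cvg_seriesZ _ lam (lp_norm p a ^+ 2) mercer_lam_summable).
move=> /(_ cw); have w0 z : Omega z ->
    series (fun k => a k * Num.sqrt (lam k) * e k z) @ \oo --> (0 : R).
  by move=> /a0; rewrite /feature; under eq_fun do rewrite mulrA.
by move=> /(_ w0) /eqP; rewrite mulf_eq0 sqrtr_eq0 leNgt lam0 orbF => /eqP.
Qed.

(** Two coefficient sequences of [g] differ by one of the zero function, so the choice made by
    [B_coef] is forced. *)
Lemma B_normE {p g a} : 1 <= p -> is_coef Omega phi p g a ->
  B_norm Omega phi p g = lp_norm p a.
Proof.
move=> p1 [fa ga]; rewrite /B_norm; suff -> : B_coef Omega phi p g = a by [].
rewrite /B_coef; case: xgetP => [b _ [fb gb]|/(_ a)]; last first.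
  by move=> /(_ (conj fa ga)).
apply/funext => j; apply/eqP; rewrite -subr_eq0; apply/eqP.
apply: (coef_eq0 _ _ p1 (in_lpB p1 fb fa)) => z Oz.
rewrite -(subrr (g z)); under eq_fun do rewrite mulrBl.
exact: cvg_seriesB (gb z Oz) (ga z Oz).
Qed.

End mercer_theory.

(** * Minimisation of coercive functions on finite-dimensional spaces *)

Section coercive_min.
Context {R : realType}.

Lemma lipschitz_continuous (V : normedModType R) (C : R) (g : V -> R) :
  (forall u v, g u <= g v + C * `|u - v|) -> continuous g.
Proof.
move=> gC v; apply/cvgrPdist_le => eps eps0; near=> u.
(* The divisor [|C| + 1] is positive whatever the sign of [C]. *)
have uv : `|v - u| <= eps / (`|C| + 1).
  near: u; apply/nbhs_normP; exists (eps / (`|C| + 1)) => [|u /ltW//].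
  by rewrite /= divr_gt0// ltr_wpDl.
have C1 : 0 < `|C| + 1 by rewrite ltr_wpDl.
have {uv} : C * `|v - u| <= eps.
  rewrite (@le_trans _ _ ((`|C| + 1) * `|v - u|))//.
    by rewrite ler_wpM2r// (le_trans (ler_norm _))// lerDl.
  by rewrite mulrC -ler_pdivlMr.
by have := gC u v; have := gC v u; rewrite distrC ler_norml; lra.
Unshelve. all: by end_near. Qed.

(** Expand [v] in the standard basis; each coordinate is at most the max norm. The sum serves below
    as a Lipschitz constant. *)
Lemma sublinear_le n (h : 'rV[R]_n -> R) :
  (forall t v, h (t *: v) = `|t| * h v) ->
  (forall u v, h (u + v) <= h u + h v) ->
  (forall v, 0 <= h v) ->
  forall v, h v <= (\sum_i h (delta_mx ord0 i)) * `|v|.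
Proof.
move=> hZ hD h_ge0 v; rewrite {1}[v]row_sum_delta mulr_suml.
elim/big_ind2 : _ => [|x1 x2 y1 y2 h1 h2|i _].
- by rewrite -(scale0r 0) hZ normr0 mul0r.
- by rewrite (le_trans (hD _ _))// lerD.
- by rewrite hZ mulrC ler_wpM2l//; exact: ler_rV_norm.
Qed.

(** By compactness [h] attains a minimum on the unit sphere, positive by definiteness; homogeneity
    extends the bound to all vectors. *)
Lemma norm_ge_rV n (h : 'rV[R]_n -> R) :
  (forall t v, h (t *: v) = `|t| * h v) ->
  (forall u v, h (u + v) <= h u + h v) ->
  (forall v, 0 <= h v) -> (forall v, h v = 0 -> v = 0) ->
  exists2 delta, 0 < delta & forall v, delta * `|v| <= h v.
Proof.
move=> hZ hD h_ge0 h_eq0; pose S := [set v : 'rV[R]_n | `|v| = 1].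
have normalize v : v != 0 -> S (`|v|^-1 *: v).
  by move=> v0; rewrite /S/= normrZ normfV normr_id mulVf ?normr_eq0.
have ch : continuous h.
  apply: (@lipschitz_continuous _ (\sum_i h (delta_mx ord0 i))) => u v.
  by rewrite -lerBlDl (le_trans _ (sublinear_le _ _ hZ hD h_ge0 _))//
    lerBlDl -{1}(subrKC v u) hD.
(* If the sphere is empty, every vector is zero and any constant works. *)
have [S0|] := pselect (S !=set0); last first.
  move=> nS; exists 1 => // v; have [->|/normalize Sv] := eqVneq v 0.
    by rewrite normr0 mulr0.
  by case: nS; exists (`|v|^-1 *: v).
have cS : compact S.
  apply: bounded_closed_compact.
    by exists 1; split => // x x1 v /= ->; exact: ltW.
  rewrite (_ : S = Num.norm @^-1` [set 1])//; apply: preimage_closed.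
    by move=> v _; exact: norm_continuous.
  exact: closed_eq.
have [c] := compact_EVT_min S0 cS (continuous_subspaceT ch).
rewrite inE => Sc cmin; exists (h c) => [|v].
  rewrite lt_neqAle h_ge0 andbT eq_sym; apply/eqP => /h_eq0 c0.
  by move: Sc; rewrite /S/= c0 normr0 => /esym/eqP; rewrite oner_eq0.
have [->|v0] := eqVneq v 0; first by rewrite normr0 mulr0.
have := cmin _ (mem_set (normalize _ v0)).
by rewrite hZ normfV normr_id mulrC ler_pdivlMr ?normr_gt0.
Qed.

(** Here [g] models the distance from a fixed vector to a linear combination and [h] the norm of
    that combination. The minimum of [g] over a large compact ball is global. *)
Lemma coercive_min n (g h : 'rV[R]_n -> R) :
  (forall t v, h (t *: v) = `|t| * h v) ->
  (forall u v, h (u + v) <= h u + h v) ->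
  (forall v, 0 <= h v) -> (forall v, h v = 0 -> v = 0) ->
  (forall u v, g u <= g v + h (u - v)) -> (forall v, h v <= g 0 + g v) ->
  exists u, forall v, g u <= g v.
Proof.
move=> hZ hD h_ge0 h_eq0 gh hg.
have [delta delta0 hdelta] := norm_ge_rV _ _ hZ hD h_ge0 h_eq0.
have cg : continuous g.
  apply: (@lipschitz_continuous _ (\sum_i h (delta_mx ord0 i))) => u v.
  by rewrite (le_trans (gh u v))// lerD2l sublinear_le.
have g0 : 0 <= g 0 by have := hg 0; have := h_ge0 0; lra.
(* Beyond this radius [h v >= 2 g 0], so [g v >= h v - g 0 >= g 0]. *)
pose M := 2 * g 0 / delta; pose B := [set v : 'rV[R]_n | `|v| <= M].
have cB : compact B.
  apply: bounded_closed_compact.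
    exists M; split; rewrite ?num_real// => x Mx v /le_trans; apply.
    exact: ltW.
  rewrite (_ : B = Num.norm @^-1` [set x | x <= M])//; apply: preimage_closed.
    by move=> v _; exact: norm_continuous.
  exact: closed_le.
have B0 : B 0 by rewrite /B/= normr0 divr_ge0 ?mulr_ge0// ltW.
have [u] := compact_EVT_min (ex_intro _ _ B0) cB (continuous_subspaceT cg).
move=> _ umin; exists u => v; have [vM|] := leP `|v| M.
  by apply: umin; rewrite inE.
rewrite ltr_pdivrMr// => /ltW vM; apply: le_trans (umin _ (mem_set B0)) _.
by have := hg v; have := hdelta v; lra.
Qed.

End coercive_min.

(** * The coefficients of the tensor interpolant *)

Section tensor.
Context {R : realType} {d : nat}.
Variables (Omega : set 'rV[R]_d) (phi : nat -> 'rV[R]_d -> R).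
Hypothesis phi_l1 : forall z, Omega z -> cvgn [normed series (phi^~ z)].
Variables (n : nat) (x : 'I_n -> 'rV[R]_d) (x_Omega : forall i, Omega (x i)).
Implicit Types (c : 'cV[R]_n).

(** Turns the tensor equation into interpolation conditions at the points [x i]. *)
Lemma tensor_A_applyE m c i :
  tensor_A_apply phi x m c i ord0 = tensor_B_apply phi x m (x i) c.
Proof.
rewrite mxE; apply: eq_bigr => t _; congr (_ * _).
by rewrite /tensor_A /tensor_B; congr Phi; apply/val_inj.
Qed.

(** Exchange the finite sum over tuples with the series, then apply [sum_tuple_prod] to each
    term. *)
Lemma tensor_B_apply_series m z c : Omega z ->
  series (fun k => phi k z * (\sum_j c j ord0 * phi k (x j)) ^+ m.-1) @ \oo -->
  tensor_B_apply phi x m z c.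
Proof.
(* A bound common to all points makes each product over a tuple at most [C ^ (m - 1)]; summability
   comes from the remaining factor [phi k z]. *)
move=> Oz; have [C xC] : exists C : R, forall i k, `|phi k (x i)| <= C.
  have /choice[C HC] i : exists C : R, forall k, `|phi k (x i)| <= C.
    by have [C _ hC] := normed_series_bounded (phi_l1 _ (x_Omega i)); exists C.
  exists (\sum_i `|C i|) => i k.
  rewrite (le_trans (HC i k))// (le_trans (ler_norm _))// (bigD1 i)//= lerDl.
  by rewrite sumr_ge0.
rewrite /tensor_B_apply; under [X in _ --> X]eq_bigr do rewrite mulrC.
rewrite [X in series X](_ : _ = fun k => \sum_(t : m.-1.-tuple 'I_n)
    (\prod_(j < m.-1) c (tnth t j) ord0) *
    (phi k z * \prod_(j < m.-1) phi k (x (tnth t j)))).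
  apply: cvg_series_lin => t; rewrite /tensor_B /Phi.
  have -> : (fun k =>
        \prod_(i < m.-1.+1) phi k (tnth [tuple of z :: map x t] i)) =
      (fun k => phi k z * \prod_(j < m.-1) phi k (x (tnth t j))).
    apply/funext => k; rewrite big_ord_recl tnth0; congr (_ * _).
    by apply: eq_bigr => j _; rewrite tnthS tnth_map.
  apply/normed_cvg/(@normed_series_mul_bounded _ (phi^~ z) _ (C ^+ m.-1)).
    exact: phi_l1.
  move => k; rewrite normr_prod -[m.-1 in leRHS]card_ord -prodr_const.
  by apply: ler_prod => j _; rewrite normr_ge0 xC.
apply/funext => k; rewrite -sum_tuple_prod mulr_sumr; apply: eq_bigr => t _.
by rewrite mulrCA -big_split.
Qed.

End tensor.

(** * Existence of the best approximation, and minimality of the interpolant *)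

Section generalized_interpolation.
Context {R : realType} {d : nat}.
Variables (Omega : set 'rV[R]_d) (Phi2 : 'rV[R]_d -> 'rV[R]_d -> R).
Variables (lam : nat -> R) (e : nat -> 'rV[R]_d -> R).
Hypothesis HOmega : mercer_setting Omega Phi2 lam e.
Variables (n : nat) (x : 'I_n -> 'rV[R]_d).
Hypothesis x_Omega : forall i, Omega (x i).
Local Notation phi := (feature lam e).

Let phi_l1 z (Oz : Omega z) : cvgn [normed series (phi^~ z)] :=
  mercer_summable HOmega Oz.

Let phi_lp m z : (0 < m)%N -> Omega z -> in_lp m%:R (phi^~ z).
Proof. by move=> m0 Oz; apply: l1_in_lp => //; exact: phi_l1. Qed.

(** Otherwise the Mercer expansion makes the quadratic form of the kernel vanish at a nonzero [v],
    against positive definiteness. *)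
Lemma features_free (v : 'rV[R]_n) : injective x ->
  (forall k, \sum_i v ord0 i * phi k (x i) = 0) -> v = 0.
Proof.
move=> x_inj v0; apply/eqP; rewrite -[_ == _]negbK; apply/negP => vn0.
have vT0 : v^T != 0 by apply: contra vn0 => /eqP vT; rewrite -[v]trmxK vT trmx0.
have := mercer_posdef HOmega x_inj x_Omega vT0.
suff S0 i : \sum_j v ord0 j * Phi2 (x i) (x j) = 0.
  rewrite big1 ?ltxx// => i _.
  transitivity (v ord0 i * \sum_j v ord0 j * Phi2 (x i) (x j)); last first.
    by rewrite S0 mulr0.
  rewrite mulr_sumr; apply: eq_bigr => j _.
  by rewrite !mxE; ring.
have := @cvg_series_lin _ _ (v ord0) (fun j k => phi k (x i) * phi k (x j)) _
  (fun j => mercer_series _ _ _ _ HOmega _ _ (x_Omega i) (x_Omega j)).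
rewrite (_ : series _ = cst 0).
  by move=> /(cvg_unique _ (cvg_cst _)) <-.
apply/funext => N; rewrite /series/= big1// => k _.
by under eq_bigr do rewrite mulrCA; rewrite -mulr_sumr v0 mulr0.
Qed.

(** The Mercer expansion gives [Phi2 z] the coefficients [phi k z], which [l1_in_lp] places in l^m;
    the rest is linearity. *)
Lemma is_coef_power_residual m z (theta : 'cV[R]_n) : (0 < m)%N -> Omega z ->
  is_coef Omega phi m%:R (power_residual x Phi2 z theta)
    (fun k => phi k z - \sum_i theta i ord0 * phi k (x i)).
Proof.
move=> m0 Oz; have m1 : 1 <= (m%:R : R) by rewrite ler1n.
split.
  apply: in_lpB => //; first exact: phi_lp.
  by apply: in_lp_lin => // i; exact: phi_lp.
move=> w Ow; have mer z' := mercer_series _ _ _ _ HOmega z' w.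
have := cvg_seriesB (mer z Oz Ow)
  (cvg_series_lin (t := theta^~ ord0) (fun i => mer (x i) (x_Omega i) Ow)).
rewrite /power_residual.
under [X in series X @ _ --> _ -> _]eq_fun.
  move=> k; under eq_bigr do rewrite mulrA.
  by rewrite -mulr_suml -mulrBl; over.
exact.
Qed.

(** By [B_normE] the problem is a minimisation in l^m, to which [coercive_min] applies;
    [features_free] supplies definiteness. *)
Lemma power_function_attained m z : (0 < m)%N -> injective x -> Omega z ->
  power_norms Omega phi x m Phi2 z (power_function Omega phi x m Phi2 z).
Proof.
move=> m0 x_inj Oz; have m1 : 1 <= (m%:R : R) by rewrite ler1n.
have m0' : 0 < (m%:R : R) by rewrite ltr0n.
pose L (v : 'rV[R]_n) k := \sum_i v ord0 i * phi k (x i).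
have fL v : in_lp m%:R (L v) by apply: in_lp_lin => // i; exact: phi_lp.
have fB v : in_lp m%:R (fun k => phi k z - L v k).
  by apply: in_lpB => //; exact: phi_lp.
have LD u v : L (u + v) = fun k => L u k + L v k.
  apply/funext => k; rewrite /L -big_split; apply: eq_bigr => i _.
  by rewrite !mxE mulrDl.
have LZ t v : L (t *: v) = fun k => t * L v k.
  apply/funext => k; rewrite /L mulr_sumr; apply: eq_bigr => i _.
  by rewrite !mxE mulrA.
have L0 k : L 0 k = 0 by apply: big1 => i _; rewrite mxE mul0r.
have [u umin] : exists u, forall v,
    lp_norm m%:R (fun k => phi k z - L u k) <=
    lp_norm m%:R (fun k => phi k z - L v k).
  apply: (@coercive_min _ _ _ (fun v => lp_norm m%:R (L v))).
  - by move=> t v; rewrite LZ lp_normZ.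
  - by move=> u v; rewrite LD; exact: lp_normD.
  - by move=> v; exact: lp_norm_ge0.
  - move=> v v0; apply: (features_free v x_inj) => k; apply/eqP.
    by rewrite -normr_le0 -[leRHS]v0; exact: lp_norm_coef k m0' (fL v).
  - move=> u v; have -> : (fun k => phi k z - L u k) =
        (fun k => (phi k z - L v k) - L (u - v) k).
      by apply/funext => k; rewrite LD -(scaleN1r v) LZ; ring.
    exact: lp_normB.
  - move=> v; rewrite [X in lp_norm _ X <= _](_ : _ =
        (fun k => (phi k z - L 0 k) - (phi k z - L v k))).
      exact: lp_normB.
    by apply/funext => k; rewrite L0; ring.
(* The minimisation ran over row vectors, while [theta] is a column. *)
have normE theta : B_norm Omega phi m%:R (power_residual x Phi2 z theta) =
    lp_norm m%:R (fun k => phi k z - L theta^T k).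
  rewrite (B_normE _ _ _ _ HOmega m1 (is_coef_power_residual m z theta m0 Oz)).
  congr lp_norm; apply/funext => k; congr (_ - _).
  by apply: eq_bigr => i _; rewrite mxE.
suff -> : power_function Omega phi x m Phi2 z =
    B_norm Omega phi m%:R (power_residual x Phi2 z u^T) by exists u^T.
have lbP : lbound (power_norms Omega phi x m Phi2 z)
    (B_norm Omega phi m%:R (power_residual x Phi2 z u^T)).
  by move=> _ [theta _ <-]; rewrite !normE trmxK; exact: umin.
apply/eqP; rewrite eq_le; apply/andP; split.
  by apply: ge_inf; [eexists; exact: lbP|exists u^T].
by apply: lb_le_inf => //; eexists; exists u^T.
Qed.

(** The minimal-norm property of the interpolant, from which the factor 2 of the theorem arises. *)
Lemma interpolant_coef_le m p (c : 'cV[R]_n) (f : 'rV[R]_d -> R)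
    (a : nat -> R) :
  ~~ odd m -> (1 < m)%N -> p = m%:R / (m%:R - 1) ->
  is_coef Omega phi p f a ->
  (forall i, tensor_B_apply phi x m (x i) c = f (x i)) ->
  lp_norm p (fun k => (\sum_j c j ord0 * phi k (x j)) ^+ m.-1) <= lp_norm p a.
Proof.
move=> m_even m1 pE [fa af] sf; pose u k := \sum_j c j ord0 * phi k (x j).
have m1' : 1 <= (m%:R : R) by rewrite ler1n ltnW.
have m1'' : 1 < (m%:R : R) by rewrite ltr1n.
have mE : m = m.-1.+1 by rewrite prednK// ltnW.
have fu : in_lp m%:R u.
  by apply: in_lp_lin => // i; apply: phi_lp => //; exact: ltnW.
have [fb bE] := lp_norm_exprn_conj m1 fu.
rewrite pE bE -pE.
(* Pairing the values at the points with [c] gives this series and the next one the same sum. *)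
have h1 : series (fun k => u k ^+ m) @ \oo --> \sum_i c i ord0 * f (x i).
  have := @cvg_series_lin _ _ (c^~ ord0)
    (fun i k => phi k (x i) * u k ^+ m.-1) _
    (fun i => tensor_B_apply_series _ _ phi_l1 _ _ x_Omega m _ c (x_Omega i)).
  under [X in _ --> X -> _]eq_bigr do rewrite sf.
  rewrite (_ : (fun k => \sum_i _) = fun k => u k ^+ m)//; apply/funext => k.
  by under eq_bigr do rewrite mulrA; rewrite -mulr_suml -/(u k) -exprS -mE.
have h2 : series (fun k => u k * a k) @ \oo --> \sum_i c i ord0 * f (x i).
  have := @cvg_series_lin _ _ (c^~ ord0)
    (fun i k => a k * phi k (x i)) _ (fun i => af (x i) (x_Omega i)).
  rewrite (_ : (fun k => \sum_i _) = fun k => u k * a k)//; apply/funext => k.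
  by rewrite mulr_suml; apply: eq_bigr => i _; rewrite mulrA mulrAC.
have p0 : 0 < p by rewrite pE divr_gt0 ?subr_gt0// (lt_trans ltr01).
have pq : (m%:R : R)^-1 + p^-1 = 1.
  rewrite pE invf_div -[X in X + _]mul1r -mulrDl subrKC divff//.
  by rewrite gt_eqF// (lt_trans ltr01).
have [_ H] := lp_hoelder (lt_trans ltr01 m1'') p0 pq fu fa.
rewrite (cvg_lim _ h2)// in H.
(* Evenness of [m] removes the absolute value, so [h1] computes the [m]-th power of the norm of
   [u]. *)
have um k : `|u k| `^ m%:R = u k ^+ m.
  by rewrite powR_mulrn// -normrX ger0_norm// exprn_even_ge0.
have UE : lp_norm m%:R u ^+ m = \sum_i c i ord0 * f (x i).
  rewrite -powR_mulrn ?lp_norm_ge0// lp_norm_powR ?(lt_trans ltr01)//.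
  by under eq_fun do rewrite um; exact: cvg_lim h1.
rewrite -UE in H; have := @lp_norm_ge0 _ m%:R u.
(* If [u] has norm zero, the left side is [0 ^ (m - 1) = 0] as [m > 1]; otherwise one factor of the
   norm cancels in Hoelder's inequality. *)
rewrite le_eqVlt => /predU1P[<-|u0].
  by rewrite expr0n -leqn0 -ltnS prednK ?(ltnW m1)// leqNgt m1 lp_norm_ge0.
move: H; rewrite (ger0_norm (exprn_ge0 m (ltW u0))) [X in _ ^+ X <= _]mE exprS.
by rewrite ler_pM2l.
Qed.

End generalized_interpolation.

(** * The error estimate *)

Theorem theorem4p5 (R : realType) (d : nat) (Omega : set 'rV[R]_d)
    (Phi2 : 'rV[R]_d -> 'rV[R]_d -> R)
    (lam : nat -> R) (e : nat -> 'rV[R]_d -> R)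
    (HOmega : mercer_setting Omega Phi2 lam e)
    (m : nat) (m_gt0 : (0 < m)%N) (m_even : ~~ odd m)
    (n : nat) (x : 'I_n -> 'rV[R]_d)
    (x_Omega : forall i, Omega (x i)) (x_inj : injective x)
    (f : 'rV[R]_d -> R)
    (f_B : in_B Omega (feature lam e) (m%:R / (m%:R - 1)) f)
    (y : 'cV[R]_n) (y_f : forall i, y i ord0 = f (x i))
    (c : 'cV[R]_n) (c_sol : tensor_A_apply (feature lam e) x m c = y) :
  let s z := tensor_B_apply (feature lam e) x m z c in
  let P z := power_function Omega (feature lam e) x m Phi2 z in
  forall z, Omega z ->
    (* the infimum defining P z is a minimum *)
    power_norms Omega (feature lam e) x m Phi2 z (P z) /\
    `|s z - f z| <=
      2 * B_norm Omega (feature lam e) (m%:R / (m%:R - 1)) f * P z.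
Proof.
move=> s P z Oz.
have Pz := power_function_attained _ _ _ _ HOmega _ _ x_Omega m z
  m_gt0 x_inj Oz.
(* From here on [theta] attains the minimum, and [P z] is the norm of its residual. *)
split=> //; case: Pz => theta _; rewrite -/(P z) => <-.
(* Being positive and even, [m] is at least 2, so the exponent [m / (m - 1)] does not divide by
   zero. *)
have m1 : (1 < m)%N by case: m m_gt0 m_even {f_B c_sol s P theta} => [|[]].
have m1R : 1 < (m%:R : R) by rewrite ltr1n.
have m0R : 0 < (m%:R : R) by exact: lt_trans m1R.
set p := _ / _ in f_B *; have [a aP] := f_B.
have p1 : 1 <= p by rewrite ler_pdivlMr ?subr_gt0// mul1r gerBl.
have pq : (m%:R : R)^-1 + p^-1 = 1.
  by rewrite /p invf_div -[X in X + _]mul1r -mulrDl subrKC divff// gt_eqF.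
have sf i : s (x i) = f (x i) by rewrite -y_f -c_sol tensor_A_applyE.
have phi_l1 w (Ow : Omega w) := mercer_summable HOmega Ow.
pose b k := (\sum_j c j ord0 * feature lam e k (x j)) ^+ m.-1.
pose r k := feature lam e k z - \sum_i theta i ord0 * feature lam e k (x i).
have ba : lp_norm p b <= lp_norm p a.
  exact: (interpolant_coef_le _ _ _ _ HOmega _ _ x_Omega _ _ _ _ _
    m_even m1 _ aP sf).
have rP := is_coef_power_residual _ _ _ _ HOmega _ _ x_Omega m z theta m_gt0 Oz.
rewrite (B_normE _ _ _ _ HOmega p1 aP).
rewrite (B_normE _ _ _ _ HOmega (ltW m1R) rP) -/r.
have fb : in_lp p b.
  apply: (lp_norm_exprn_conj m1 _).1; apply: in_lp_lin; first exact: ltW.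
  by move=> i; apply: l1_in_lp => //; exact: phi_l1.
have sfE w : Omega w ->
    series (fun k => feature lam e k w * (b k - a k)) @ \oo --> s w - f w.
  move=> Ow.
  have := cvg_seriesB (tensor_B_apply_series _ _ phi_l1 _ _ x_Omega m w c Ow)
    (aP.2 w Ow).
  rewrite (_ : (fun k => _ - _) = fun k => feature lam e k w * (b k - a k))//.
  by apply/funext => k; rewrite mulrBr [a k * _]mulrC.
(* Subtracting the errors at the points, which are all zero, replaces [phi_k(z)] by [r_k] without
   changing the sum. *)
have rE : series (fun k => r k * (b k - a k)) @ \oo --> s z - f z.
  have := cvg_seriesB (sfE z Oz)
    (cvg_series_lin (t := theta^~ ord0) (fun i => sfE (x i) (x_Omega i))).
  rewrite [X in _ --> _ - X -> _]big1 ?subr0; last first.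
    by move=> i _; rewrite sf subrr mulr0.
  rewrite (_ : (fun k => _ - _) = fun k => r k * (b k - a k))//.
  apply/funext => k; rewrite /r mulrBl mulr_suml; congr (_ - _).
  by apply: eq_bigr => i _; rewrite mulrA.
have [_] := lp_hoelder m0R (lt_le_trans ltr01 p1) pq rP.1 (in_lpB p1 fb aP.1).
rewrite (cvg_lim _ rE)// => /le_trans; apply.
(* The factor 2 comes from [|b - a| <= |b| + |a| <= 2 |a|], by [ba]. *)
rewrite mulrC ler_wpM2r ?lp_norm_ge0//.
by rewrite (le_trans (lp_normB p1 fb aP.1))//; lra.
Qed.
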